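(* The cycle $C_4$ of length $4$ is, up to isomorphism, the unique Pfaffian, cycle-conformal brace. That is, $C_4$ is a Pfaffian, cycle-conformal brace, and every brace that is both Pfaffian and cycle-conformal is isomorphic to $C_4$.
   Context: Graphs are finite, without loops or multiple edges. A brace is a $2$-connected, bipartite graph in which any matching of size at most two can be extended to a perfect matching of the graph (in particular $C_4$ is a brace; $K_2$ is not). A cycle $C \subseteq G$ is conformal if $G - V(C)$ has a perfect matching (the empty graph counts as having a perfect matching). A graph is cycle-conformal if it has a perfect matching and all of its even cycles are conformal. A graph with a perfect matching is Pfaffian if there exists an orientation of its edges such that each conformal, even cycle has an odd number of edges oriented in the same direction in either direction of traversal. *)

(* Defs.v *)
From mathcomp Require Import all_boot.

Set Implicit Arguments.
Unset Strict Implicit.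
Unset Printing Implicit Defensive.

Record sgraph := SGraph {
  vertex :> finType;
  edge : rel vertex;
  edge_sym : symmetric edge;
  edge_irrefl : irreflexive edge }.

Definition isomorphic (G H : sgraph) : Prop :=
  exists2 f : G -> H, bijective f & forall x y : G, edge (f x) (f y) = edge x y.

Definition C4_edge : rel 'I_4 := [rel i j | (j == ordS i) || (i == ordS j)].

Lemma C4_edge_sym : symmetric C4_edge.
Proof. by move=> i j; rewrite /C4_edge /= orbC. Qed.

Lemma C4_edge_irrefl : irreflexive C4_edge.
Proof. by case=> -[|[|[|[|//]]]] ?. Qed.

Definition C4 : sgraph := SGraph C4_edge_sym C4_edge_irrefl.

Section Graph.
Variable G : sgraph.

Definition bipartite : Prop :=
  exists A : {set G}, forall x y : G, edge x y -> (x \in A) != (y \in A).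

(* Any two vertices of S are joined by a path of the induced subgraph G[S]. *)
Definition connected_on (S : {set G}) : Prop :=
  {in S &, forall x y,
    connect [rel u v : G | [&& u \in S, v \in S & edge u v]] x y}.

(* The bound on the number of vertices is the usual convention for
   k-connectivity (more than k vertices); it excludes K_2. *)
Definition two_connected : Prop :=
  2 < #|G| /\ forall X : {set G}, #|X| < 2 -> connected_on (~: X).

Definition edge_set : {set {set G}} :=
  [set [set x; y] | x in [set: G], y in [set: G] & edge x y].

Definition matching (M : {set {set G}}) : bool :=
  (M \subset edge_set) && trivIset M.

(* M is a perfect matching of the induced subgraph G[S]: the edges of M cover
   exactly S, so they all lie inside S. *)
Definition perfect_matching_on (S : {set G}) (M : {set {set G}}) : bool :=
  matching M && (cover M == S).

Definition perfect_matching (M : {set {set G}}) : bool :=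
  perfect_matching_on [set: G] M.

Definition has_perfect_matching : Prop := exists M, perfect_matching M.

Definition brace : Prop :=
  [/\ two_connected, bipartite &
      forall M : {set {set G}}, matching M -> #|M| <= 2 ->
        exists2 N, perfect_matching N & M \subset N].

(* A cycle of G is represented by the sequence of its vertices in one of its
   traversals: c stands for the cycle whose edges are {x, next c x}, x \in c. *)
Definition is_cycle (c : seq G) : bool :=
  [&& 2 < size c, cycle (@edge G) c & uniq c].

Definition even_cycle (c : seq G) : bool := is_cycle c && ~~ odd (size c).

Definition conformal (c : seq G) : Prop :=
  exists M, perfect_matching_on (~: [set x in c]) M.

Definition cycle_conformal : Prop :=
  has_perfect_matching /\ forall c : seq G, even_cycle c -> conformal c.

(* o x y means that the edge xy is oriented from x to y. *)
Definition orientation (o : rel G) : Prop :=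
  (forall x y, o x y -> edge x y) /\
  (forall x y, edge x y -> o x y (+) o y x).

Definition forward_edges (o : rel G) (c : seq G) : nat :=
  count (fun x => o x (next c x)) c.

Definition backward_edges (o : rel G) (c : seq G) : nat :=
  count (fun x => o (next c x) x) c.

Definition pfaffian : Prop :=
  has_perfect_matching /\
  exists2 o : rel G, orientation o &
    forall c : seq G, even_cycle c -> conformal c ->
      odd (forward_edges o c) /\ odd (backward_edges o c).

End Graph.

(* Main.v *)
Require Import Defs.
From mathcomp Require Import all_boot.

Set Implicit Arguments.
Unset Strict Implicit.
Unset Printing Implicit Defensive.

(** Why C4 is the only Pfaffian, cycle-conformal brace.

    All cycles of a bipartite graph are even, so in a cycle-conformal, Pfaffian,
    bipartite graph a Pfaffian orientation gives every cycle an odd number of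
    forward edges. Such an orientation cannot exist on a graph containing a
    theta: two vertices x and w joined by three internally disjoint paths, one
    of which, x z w, has length two. Indeed, traverse the three cycles of the
    theta so that the other two paths are each used twice in the same direction
    and x z w once in each direction. The three forward counts then add up
    to an even number, each edge of x z w contributing one, whereas a sum of
    three odd numbers is odd ([not_all_cycles_odd]).

    Every graph of minimum degree three contains such a theta. It is obtained
    by Posa rotations of a longest path: all the neighbors of the first vertex
    of a longest path lie on it, so reversing an initial segment yields longest
    paths with other first vertices, and minimizing the length of that segment
    forces the required pair of chords ([exists_chorded_path]).

    Hence a Pfaffian, cycle-conformal brace has a vertex v with at most two
    neighbors a and b. If a and b had distinct further neighbors x and y, no
    perfect matching containing ax and by could cover v; so a and b have a
    single further neighbor, common to both, which would be a cut vertex if the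
    graph had a fifth vertex ([brace_degree2_C4]). *)

(** * Parity of the number of forward edges *)

Section ForwardParity.
Variables (T : eqType) (o : rel T).

(** The parity of the number of steps of the walk x :: p that follow o. A walk
    need not be closed, so the parity of a cycle can be computed from the paths
    that it is made of. *)
Fixpoint forward_parity (x : T) (p : seq T) : bool :=
  if p is y :: p' then o x y (+) forward_parity y p' else false.

Lemma forward_parity_cat x p q :
  forward_parity x (p ++ q) =
  forward_parity x p (+) forward_parity (last x p) q.
Proof. by elim: p x => [|y p IHp] x //=; rewrite IHp addbA. Qed.

Lemma odd_count_fpath (f : T -> T) x p :
  fpath f x p ->
  odd (count (fun u => o u (f u)) (belast x p)) = forward_parity x p.
Proof.
elim: p x => [|y p IHp] x //= /andP[/eqP <- /IHp].
by rewrite oddD oddb => ->.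
Qed.

End ForwardParity.

Lemma odd_forward_edges (G : sgraph) (o : rel G) (x : G) (p : seq G) :
  uniq (x :: p) ->
  odd (forward_edges o (x :: p)) = forward_parity o x (rcons p x).
Proof. by move=> /cycle_next /(odd_count_fpath o); rewrite belast_rcons. Qed.

Lemma bipartite_cycle_even (G : sgraph) (c : seq G) :
  bipartite G -> is_cycle c -> even_cycle c.
Proof.
move=> [A sidesA] cyc_c; rewrite /even_cycle cyc_c /=.
have side_last x p :
    path (@edge G) x p -> (last x p \in A) = (x \in A) (+) odd (size p).
  elim: p x => [|y p IHp] x /=; first by rewrite addbF.
  case/andP=> /sidesA sides_xy /IHp ->.
  by case: (x \in A) (y \in A) (odd _) sides_xy => [] [] [].
case/and3P: cyc_c; case: c => //= x p _ /side_last + _.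
by rewrite last_rcons size_rcons /=; case: (x \in A) (odd _) => [] [].
Qed.

(** * A path with two chords *)

Lemma mem_split (T : eqType) (x : T) s :
  x \in s -> exists p q, s = p ++ x :: q.
Proof. by case/splitPr=> p q; exists p, q. Qed.

(** The rotation of the path x :: p ++ z :: q along the edge xz. *)
Lemma rotate_path (T : eqType) (e : rel T) x p z q :
  symmetric e -> path e x (p ++ z :: q) -> e x z ->
  path e (last x p) (rev (belast x p) ++ z :: q).
Proof.
move=> sym_e; rewrite !cat_path /= => /and3P[xp _ zq] xz.
have -> : last (last x p) (rev (belast x p)) = x.
  by case: (p) => //= y p'; rewrite rev_cons last_rcons.
rewrite rev_path xz zq !andbT.
by apply: sub_path xp => u v /=; rewrite sym_e.
Qed.

Lemma path_between_members (T : eqType) (e : rel T) x q m y :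
  symmetric e -> path e x q -> uniq q -> m \in q -> y \in q ->
  exists r, [/\ path e m r, last m r = y, uniq (m :: r)
              & {subset m :: r <= q}].
Proof.
move=> sym_e + + mq yq; case/splitPr: yq mq => q1 q2 mq.
rewrite cat_path cat_uniq /= => /and3P[xq1 q1y yq2] /and4P[uq1 + yNq2 uq2].
case/norP=> yNq1 _; move: mq; rewrite mem_cat inE => /or3P[mq1|/eqP->|mq2].
- case/splitPr: mq1 xq1 q1y uq1 yNq1 => r1 r2.
  rewrite cat_path last_cat cat_uniq /= => /and3P[_ _ mr2] r2y.
  case/and4P=> _ _ mNr2 ur2; rewrite mem_cat inE !negb_or => /and3P[_ yNm yNr2].
  exists (rcons r2 y); rewrite last_rcons rcons_path mr2 r2y.
  split=> //; first by rewrite mem_rcons inE negb_or eq_sym yNm rcons_uniq yNr2 mNr2.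
  move=> u; rewrite inE mem_rcons !(inE, mem_cat).
  by case/or3P=> ->; rewrite ?orbT.
- by exists [::]; split=> // u; rewrite !(inE, mem_cat) => ->; rewrite orbT.
case/splitPr: mq2 yq2 yNq2 uq2 => r1 r2.
rewrite cat_path cat_uniq mem_cat inE /= => /and3P[yr1 r1m _].
case/norP=> yNr1 /norP[yNm _] /and4P[ur1 /norP[mNr1 _] _ _].
exists (rev (y :: r1)); split.
- have := rev_path e y (rcons r1 m).
  rewrite last_rcons belast_rcons => ->.
  by rewrite rcons_path -(eq_path (e := e)) ?yr1 /= ?[e m _]sym_e // => u v; rewrite sym_e.
- by rewrite rev_cons last_rcons.
- by rewrite mem_rev rev_uniq inE negb_or eq_sym yNm mNr1 /= yNr1.
move=> u; rewrite inE mem_rev !(inE, mem_cat).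
by case/or3P=> ->; rewrite ?orbT.
Qed.

Lemma exists_longest_path (T : finType) (e : rel T) :
  0 < #|T| ->
  exists x p, [/\ path e x p, uniq (x :: p) &
    forall y q, path e y q -> uniq (y :: q) -> size q <= size p].
Proof.
case/card_gt0P=> x0 _.
pose P n := [exists x, [exists t : n.-tuple T, path e x t && uniq (x :: t)]].
have exP : exists n, P n.
  by exists 0; apply/existsP; exists x0; apply/existsP; exists [tuple].
have ubP n : P n -> n <= #|T|.
  case/existsP=> x /existsP[t /andP[_ /card_uniqP card_t]].
  by apply: leq_trans (max_card (mem (x :: t))); rewrite card_t /= size_tuple.
case: (ex_maxnP exP ubP) => n /existsP[x /existsP[t /andP[xt uxt]]] max_n.
exists x, t; split=> // y q yq uyq; rewrite size_tuple; apply: max_n.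
apply/existsP; exists y; apply/existsP; exists (in_tuple q).
by apply/andP.
Qed.

(** Minimum degree at least three, in the form in which it is applied: two
    vertices never exhaust a neighborhood. *)
Definition min_degree3 (G : sgraph) : Prop :=
  forall v a b : G, exists c, [/\ edge v c, c != a & c != b].

(** Take a longest path x :: p ++ z :: q where x is adjacent to z and to a vertex
    y of q, with p nonempty and as short as possible. The last vertex w of p starts the path
    rotated along xz, so all its neighbors lie on that path. Let m be one of
    them other than z and the vertex before w. If m were on the segment
    x :: p, then m and z would be two chord ends for the rotated path, the first
    closer to its start than z was to x. Hence m lies on q. *)
Lemma exists_chorded_path (G : sgraph) :
  0 < #|G| -> min_degree3 G ->
  exists x p z q y m,
    [/\ path (@edge G) x (p ++ z :: q), uniq (x :: p ++ z :: q), p != [::],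
        y \in q & m \in q]
    /\ [/\ edge x z, edge x y & edge (last x p) m].
Proof.
move=> /exists_longest_path -/(_ (@edge G))[x0 [s [x0s ux0s max_s]]] deg3.
have on_path x p m :
    path (@edge G) x p -> uniq (x :: p) -> size p = size s -> edge x m ->
    m \in p.
  move=> xp uxp szp xm; apply/negPn/negP => mNp.
  have: size (x :: p) <= size s.
    apply: (max_s m); first by rewrite /= edge_sym xm.
    rewrite cons_uniq uxp andbT inE negb_or mNp andbT.
    by apply: contraTneq xm => ->; rewrite edge_irrefl.
  by rewrite /= szp ltnn.
(* The induction is on a bound n for the length of p. *)
suff chorded n x p z q y :
    size p < n -> path (@edge G) x (p ++ z :: q) ->
    uniq (x :: p ++ z :: q) -> p != [::] -> size (p ++ z :: q) = size s ->
    edge x z -> edge x y -> y \in q ->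
    exists x p z q y m,
    [/\ path (@edge G) x (p ++ z :: q), uniq (x :: p ++ z :: q), p != [::],
        y \in q & m \in q]
    /\ [/\ edge x z, edge x y & edge (last x p) m].
  (* Of two neighbors of x0 other than its successor on the path, the first on
     the path serves as z and the second as y. *)
  have [z1 [xz1 z1Nh _]] := deg3 x0 (head x0 s) x0.
  have [z2 [xz2 z2Nh z2Nz1]] := deg3 x0 (head x0 s) z1.
  have z1s := on_path _ _ _ x0s ux0s erefl xz1.
  have z2s := on_path _ _ _ x0s ux0s erefl xz2.
  have [p1 [p2 def_s]] := mem_split z1s.
  rewrite def_s in x0s ux0s z1Nh z2Nh.
  move: z2s; rewrite def_s mem_cat inE (negPf z2Nz1) /= => /orP[z2p1|z2p2].
    have [q1 [q2 def_p1]] := mem_split z2p1.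
    rewrite def_p1 -catA /= in def_s x0s ux0s z1Nh z2Nh.
    apply: (chorded (size q1).+1 x0 q1 z2 (q2 ++ z1 :: p2) z1) => //.
    - by apply: contraNneq z2Nh => ->.
    - by rewrite def_s.
    - by rewrite mem_cat mem_head orbT.
  apply: (chorded (size p1).+1 x0 p1 z1 p2 z2) => //.
  - by apply: contraNneq z1Nh => ->.
  - by rewrite def_s.
elim: n x p z q y => // n IHn x p z q y; rewrite ltnS => le_p_n.
move=> xpzq uxpzq p_n0 szp xz xy yq.
set w := last x p; set p1 := rev (belast x p).
have wp1 : path (@edge G) w (p1 ++ z :: q).
  by apply: rotate_path => //; apply: edge_sym.
have perm_wp1 : perm_eq (w :: p1 ++ z :: q) (x :: p ++ z :: q).
  have: perm_eq (w :: p1) (x :: p).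
    by rewrite [x :: p]lastI -/w perm_sym perm_rcons perm_cons perm_sym perm_rev.
  by rewrite -(perm_cat2r (z :: q)) !cat_cons.
have uwp1 : uniq (w :: p1 ++ z :: q) by rewrite (perm_uniq perm_wp1).
have szp1 : size (p1 ++ z :: q) = size s.
  by have /perm_size[->] := perm_wp1.
(* On the rotated path w is followed by head w p1: a neighbor m other than this
   vertex leaves a nonempty segment between w and m. *)
have [m [wm mNh mNz]] := deg3 w (head w p1) z.
have := on_path _ _ _ wp1 uwp1 szp1 wm.
rewrite mem_cat inE (negPf mNz) /= => /orP[mp1 | mq]; last first.
  by exists x, p, z, q, y, m.
have wz : edge w z by move: xpzq; rewrite cat_path => /and3P[].
have [r1 [r2 def_p1]] := mem_split mp1.
have lt_r1 : size r1 < size p.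
  have: size p1 = size p by rewrite size_rev size_belast.
  by rewrite def_p1 size_cat addnS => <-; rewrite ltnS leq_addr.
rewrite def_p1 -catA /= in wp1 uwp1 szp1 mNh.
apply: (IHn w r1 m (r2 ++ z :: q) z) => //.
- exact: leq_trans le_p_n.
- by apply: contraNneq mNh => ->.
- by rewrite mem_cat mem_head orbT.
Qed.

(** With w the last vertex of p, the chords xz, xy, wm and the part r of q from m
    to y form a theta with ends x and w: the paths are p, the path x z w, and
    w r x. *)
Lemma not_all_cycles_odd (G : sgraph) (o : rel G) :
  0 < #|G| -> min_degree3 G -> orientation o ->
  ~ (forall c, is_cycle c -> odd (forward_edges o c)).
Proof.
move=> G_gt0 deg3 [_ o_edge] odd_cycles.
have [x [p [z [q [y [m [[xpzq uxpzq p_n0 yq mq] [xz xy wm]]]]]]]] :=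
  exists_chorded_path G_gt0 deg3.
have sym_e : symmetric (@edge G) := @edge_sym G.
case/lastP: p => [//|p w] in xpzq uxpzq p_n0 wm *.
rewrite last_rcons in wm; clear p_n0.
move: xpzq; rewrite cat_path last_rcons /= => /and3P[xpw wz zq].
have uq : uniq q by move: uxpzq; rewrite /= cat_uniq /= => /and5P[].
have [r [mr rxy umr sub_r]] := path_between_members sym_e zq uq mq yq.
have uniq_theta : uniq ((x :: rcons p w) ++ z :: m :: r).
  move: uxpzq; rewrite -cat_cons !cat_uniq => /and3P[-> disj /andP[zNq _]].
  apply/and3P; split=> //; last first.
    by rewrite cons_uniq umr andbT; apply: contra zNq => /sub_r.
  apply: contra disj => /hasP[u u_zr u_xp]; apply/hasP; exists u => //.
  by move: u_zr; rewrite inE => /orP[/eqP-> | /sub_r]; rewrite inE ?eqxx // orbC => ->.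
have yx : edge y x by rewrite edge_sym.
have zx : edge z x by rewrite edge_sym.
have zw : edge z w by rewrite edge_sym.
have odd_parity c s : is_cycle (c :: s) -> forward_parity o c (rcons s c).
  by move=> cyc_c; rewrite -odd_forward_edges ?odd_cycles //; case/and3P: cyc_c.
(* p is traversed from x to w in the first and third cycles, r from w to x in the
   last two, and the path x z w once in each direction. *)
have odd1 : forward_parity o x (rcons (rcons p w ++ [:: z]) x).
  apply: odd_parity; apply/and3P; split.
  - by rewrite /= size_cat size_rcons addn1.
  - by rewrite /= rcons_path cat_path last_cat last_rcons xpw /= wz zx.
  apply: subseq_uniq uniq_theta; rewrite -cat_cons.
  by apply: cat_subseq => //=; rewrite eqxx.
have odd2 : forward_parity o x (rcons [:: z, w, m & r] x).
  apply: odd_parity; apply/and3P; split=> //.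
  - by rewrite /= rcons_path xz zw wm mr rxy yx.
  have: uniq [:: x, w, z, m & r].
    apply: subseq_uniq uniq_theta; rewrite /= eqxx -cats1 -catA /=.
    by apply: (@cat_subseq _ [::]) => //; apply: sub0seq.
  rewrite -(@perm_uniq _ [:: x, z, w, m & r]) //.
  by rewrite perm_cons (perm_catCA [:: z] [:: w]).
have odd3 : forward_parity o x (rcons (rcons p w ++ m :: r) x).
  apply: odd_parity; apply/and3P; split.
  - by rewrite /= size_cat size_rcons addnS.
  - by rewrite /= rcons_path cat_path last_cat last_rcons xpw /= wm mr rxy yx.
  apply: subseq_uniq uniq_theta; rewrite -cat_cons.
  by apply: cat_subseq => //; apply: subseq_cons.
move: (o_edge _ _ xz) (o_edge _ _ wz) odd1 odd2 odd3.
rewrite !rcons_cat !forward_parity_cat last_rcons /=.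
move: (forward_parity o x (rcons p w)) => a.
move: (o w m (+) forward_parity o m (rcons r x)) => b.
by case: (o x z) (o z x) (o w z) (o z w) a b => [] [] [] [] [] [].
Qed.

(** * Braces with a vertex of degree two *)

(** Otherwise a would separate v from any third vertex. *)
Lemma two_connected_neighbor (G : sgraph) (v a : G) :
  two_connected G -> v != a -> exists2 b, edge v b & b != a.
Proof.
move=> [G_gt2 conn] v_a.
have [u u_va] : exists u, u \notin [set v; a].
  apply/existsP; rewrite -negb_forall; apply: contraL G_gt2 => /forallP all_va.
  rewrite -leqNgt -cardsT (leq_trans (subset_leq_card (B := [set v; a]) _)) //.
    by apply/subsetP=> u _; apply: all_va.
  by rewrite cards2 v_a.
move: u_va; rewrite !inE negb_or => /andP[u_v u_a].
have a_lt2 : #|[set a]| < 2 by rewrite cards1.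
have := conn _ a_lt2 v u; rewrite !inE => /(_ v_a u_a) /connectP[[|b p]] /=.
  by move=> _ u_eq; rewrite u_eq eqxx in u_v.
by case/andP=> /and3P[_]; rewrite !inE => b_a vb _ _; exists b.
Qed.

Lemma isomorphic_C4 (G : sgraph) (v a x b : G) :
  bipartite G -> uniq [:: v; a; x; b] ->
  (forall u, u \in [:: v; a; x; b]) ->
  edge v a -> edge a x -> edge x b -> edge b v -> isomorphic G C4.
Proof.
move=> [A sides] uniq_s all_s va ax xb bv.
have lt4 u : index u [:: v; a; x; b] < 4 by rewrite (index_mem u [:: v; a; x; b]).
pose f u : C4 := Ordinal (lt4 u).
have inj_f : injective f.
  move=> u w /(congr1 val) /= eq_i.
  by rewrite -(nth_index v (all_s u)) -(nth_index v (all_s w)) /= eq_i.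
have nvx : edge v x = false.
  by apply/negP=> /sides; move: (sides _ _ va) (sides _ _ ax); do 3!case: (_ \in A).
have nab : edge a b = false.
  by apply/negP=> /sides; move: (sides _ _ ax) (sides _ _ xb); do 3!case: (_ \in A).
exists f.
  apply: inj_card_bij => //; rewrite card_ord.
  by have := max_card (mem [:: v; a; x; b]); rewrite (card_uniqP uniq_s).
have C4_edge_index u w : edge (f u) (f w) =
    let i := index u [:: v; a; x; b] in let j := index w [:: v; a; x; b] in
    (j == i.+1 %% 4) || (i == j.+1 %% 4) by [].
have [sym_e irr_e] := (@edge_sym G, @edge_irrefl G).
move=> u w; rewrite C4_edge_index; move: (all_s u) (all_s w) uniq_s.
rewrite /= !inE !negb_or -!andbA => + + /and5P[v_a v_x v_b a_x].
move=> + + /and3P[a_b x_b _].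
case/or4P=> /eqP-> /or4P[] /eqP->;
  rewrite ?eqxx ?[a == v]eq_sym ?[x == v]eq_sym ?[b == v]eq_sym ?[x == a]eq_sym
    ?[b == a]eq_sym ?[b == x]eq_sym
    ?(negPf v_a) ?(negPf v_x) ?(negPf v_b) ?(negPf a_x) ?(negPf a_b) ?(negPf x_b)
    ?irr_e ?nvx ?nab ?va ?ax ?xb ?bv //= sym_e ?nvx ?nab ?va ?ax ?xb ?bv //.
Qed.

Lemma edge_setP (G : sgraph) (s : {set G}) :
  reflect (exists x y, edge x y /\ s = [set x; y]) (s \in edge_set G).
Proof.
apply: (iffP imset2P) => [[x y _ + ->]|[x [y [xy ->]]]].
  by rewrite !inE => /= xy; exists x, y.
by exists x y; rewrite ?inE.
Qed.

Lemma trivIset_commonP (T : finType) (P : {set {set T}}) :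
  reflect (forall A B u, A \in P -> B \in P -> u \in A -> u \in B -> A = B)
    (trivIset P).
Proof.
apply: (iffP idP) => [tiP A B u PA PB uA uB | eqP_common].
  by rewrite -(def_pblock tiP PA uA) (def_pblock tiP PB uB).
apply/trivIsetP => A B PA PB; apply: contraNT => /pred0Pn[u /andP[uA uB]].
by apply/eqP; apply: eqP_common uA uB.
Qed.

Lemma matching_pair (G : sgraph) (a x b y : G) :
  edge a x -> edge b y -> uniq [:: a; x; b; y] ->
  matching [set [set a; x]; [set b; y]].
Proof.
move=> ax yb; rewrite /= !inE !negb_or.
case/and4P=> /and3P[_ a_b a_y] /andP[x_b x_y] _ _.
apply/andP; split.
  apply/subsetP=> s; rewrite !inE => /orP[] /eqP->; apply/edge_setP.
    by exists a, x.
  by exists b, y.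
apply/trivIset_commonP=> s t u; rewrite !inE.
do 2![case/orP=> /eqP->] => //; rewrite !inE => /orP[] /eqP-> /orP[] /eqP eq_u.
all: by rewrite eq_u eqxx in a_b a_y x_b x_y.
Qed.

(** By 2-connectivity a and b may be taken to be two distinct neighbors of v. For
    neighbors x' of a and y' of b other than v, if x' and y' were distinct, then
    the edge covering v in a perfect matching extending ax' and by' would share
    a or b with one of these edges; hence x' = y'. So besides v, a and b have a
    single neighbor x, the same for both, and since G minus x is connected,
    v, a, x, b are all the vertices. *)
Lemma brace_degree2_C4 (G : sgraph) (v a b : G) :
  brace G -> (forall c, edge v c -> c = a \/ c = b) -> isomorphic G C4.
Proof.
move=> [conn2 bip ext].
wlog [va vb b_a] : a b / [/\ edge v a, edge v b & b != a].
  move=> wlog_ab Nv.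
  have [w w_v] : exists w, v != w.
    apply/existsP; rewrite -negb_forall; case: conn2 => + _.
    apply: contraL => /forallP all_v; rewrite -leqNgt -cardsT.
    rewrite (leq_trans (subset_leq_card (B := [set v]) _)) ?cards1 //.
    by apply/subsetP=> u _; rewrite inE eq_sym all_v.
  have [a' va' _] := two_connected_neighbor conn2 w_v.
  have v_a' : v != a' by apply: contraTneq va' => <-; rewrite edge_irrefl.
  have [b' vb' b'_a'] := two_connected_neighbor conn2 v_a'.
  apply: (wlog_ab a' b') => // c /Nv.
  case: (Nv _ va') (Nv _ vb') b'_a' => -> [] -> ; rewrite ?eqxx //; tauto.
move=> Nv; have [A sides] := bip.
have neq (u w : G) : edge u w -> u != w.
  by apply: contraTneq => ->; rewrite edge_irrefl.
have av : edge a v by rewrite edge_sym.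
have bv : edge b v by rewrite edge_sym.
have [x ax x_v] := two_connected_neighbor conn2 (neq _ _ av).
have [y by_ y_v] := two_connected_neighbor conn2 (neq _ _ bv).
have same_neighbor x' y' :
    edge a x' -> x' != v -> edge b y' -> y' != v -> x' = y'.
  move=> ax' x'_v by' y'_v; apply/eqP/negPn/negP => x'_y'.
  have a_y' : a != y'.
    apply/eqP=> a_y'; move: (sides _ _ va) (sides _ _ vb) (sides _ _ by').
    by rewrite -a_y'; do 3!case: (_ \in A).
  have x'_b : x' != b.
    apply/eqP=> x'_b; move: (sides _ _ va) (sides _ _ vb) (sides _ _ ax').
    by rewrite x'_b; do 3!case: (_ \in A).
  have uniq4 : uniq [:: a; x'; b; y'].
    by rewrite /= !inE !negb_or neq // eq_sym b_a a_y' x'_b x'_y' neq.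
  have M_match := matching_pair ax' by' uniq4.
  have [|N /andP[/andP[N_edges /trivIset_commonP N_triv] /eqP N_cover] M_N] :=
    ext _ M_match; first by rewrite cards2; case: (_ != _).
  have axN : [set a; x'] \in N by apply: (subsetP M_N); rewrite !inE eqxx.
  have byN : [set b; y'] \in N by apply: (subsetP M_N); rewrite !inE eqxx orbT.
  have: v \in cover N by rewrite N_cover inE.
  case/bigcupP=> s sN vs.
  have /edge_setP[u [w [uw def_s]]] := subsetP N_edges _ sN.
  have [c vc def_vc] : exists2 c, edge v c & s = [set v; c].
    move: vs; rewrite def_s !inE => /orP[] /eqP->; first by exists w.
    by exists u; rewrite 1?edge_sym 1?setUC.
  have cs : c \in s by rewrite def_vc !inE eqxx orbT.
  have [def_c | def_c] := Nv _ vc; rewrite def_c in cs.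
    have := N_triv _ _ a sN axN cs; rewrite !inE eqxx => /(_ isT) def_ax.
    by move: vs; rewrite def_ax !inE eq_sym [v == x']eq_sym (negPf x'_v) (negPf (neq _ _ av)).
  have := N_triv _ _ b sN byN cs; rewrite !inE eqxx => /(_ isT) def_by.
  by move: vs; rewrite def_by !inE eq_sym [v == y']eq_sym (negPf y'_v) (negPf (neq _ _ bv)).
have xy := same_neighbor x y ax x_v by_ y_v; rewrite -xy in by_ => {y xy y_v}.
have Na c : edge a c -> c \in [:: v; x].
  move=> ac; rewrite !inE; case: eqVneq => //= c_v.
  by rewrite (same_neighbor c x).
have Nb c : edge b c -> c \in [:: v; x].
  move=> bc; rewrite !inE; case: eqVneq => //= c_v.
  by rewrite (same_neighbor x c).
have step w c : w \in [:: v; a; b] -> edge w c -> c != x -> c \in [:: v; a; b].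
  rewrite !inE => /or3P[] /eqP-> => [/Nv[]->|/Na|/Nb]; rewrite ?eqxx ?orbT //.
    by rewrite !inE => /orP[->|->].
  by rewrite !inE => /orP[->|->].
have all_s u : u \in [:: v; a; x; b].
  case: (eqVneq u x) => [->|u_x]; first by rewrite !inE eqxx !orbT.
  have x_lt2 : #|[set x]| < 2 by rewrite cards1.
  have := conn2.2 _ x_lt2 v u; rewrite !inE eq_sym x_v => /(_ isT u_x).
  case/connectP=> p path_p ->.
  suff stays w : w \in [:: v; a; b] ->
      path [rel c d | [&& c \in ~: [set x], d \in ~: [set x] & edge c d]] w p ->
      last w p \in [:: v; a; b].
    have := stays v (mem_head _ _) path_p.
    by rewrite !inE => /or3P[] ->; rewrite ?orbT.
  elim: p w {path_p} => //= c p IHp w w_s /andP[/and3P[_]].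
  by rewrite in_setC in_set1 => c_x wc; apply: IHp; apply: step wc c_x.
apply: (@isomorphic_C4 _ v a x b) => //; last by rewrite edge_sym.
rewrite /= !inE !negb_or (neq _ _ va) eq_sym x_v (neq _ _ vb) (neq _ _ ax).
by rewrite eq_sym b_a eq_sym (neq _ _ by_).
Qed.

(** * The cycle C4 *)

Lemma edge_C4_succ (i : C4) : edge i (ordS i).
Proof. by apply/orP; left. Qed.

Lemma edge_set_C4P (s : {set C4}) :
  s \in edge_set C4 -> exists i : C4, s = [set i; ordS i].
Proof.
case/edge_setP=> i [j [/orP[/eqP-> | /eqP->] ->]]; first by exists i.
by exists j; rewrite setUC.
Qed.

(** The two perfect matchings of C4, indexed by the parity of i in the edge
    joining i to its successor. *)
Definition C4_parallel_edges (b : bool) : {set {set C4}} :=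
  [set [set i; ordS i] | i : C4 & odd i == b].

Lemma C4_parallel_edges_perfect b : perfect_matching (C4_parallel_edges b).
Proof.
(* end_of u is the index of the edge of parity b that covers u. *)
pose end_of (u : C4) : C4 := if odd u == b then u else ord_pred u.
have endP (i u : C4) :
    odd i == b -> (u \in [set i; ordS i]) = (i == end_of u).
  rewrite /end_of !inE => /eqP <-.
  by case: i u => -[|[|[|[|//]]]] ? [[|[|[|[|//]]]] ?].
have end_odd u : odd (end_of u) == b.
  by rewrite /end_of; case: b u {endP end_of} => -[[|[|[|[|//]]]] ?].
apply/andP; split; first (apply/andP; split).
- apply/subsetP=> s /imsetP[i _ ->]; apply/edge_setP.
  by exists i, (ordS i); rewrite edge_C4_succ.
- apply/trivIset_commonP=> s t u /imsetP[i i_b ->] /imsetP[j j_b ->].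
  rewrite inE in i_b; rewrite inE in j_b.
  by rewrite !endP // => /eqP-> /eqP->.
apply/eqP/setP=> u; rewrite inE; apply/bigcupP.
exists [set end_of u; ordS (end_of u)]; last by rewrite endP.
by apply: imset_f; rewrite inE.
Qed.

(** Edges of different parity always meet, so a matching lies within one of the
    two pairs of opposite edges. *)
Lemma C4_matching_extends (M : {set {set C4}}) :
  matching M -> exists2 N, perfect_matching N & M \subset N.
Proof.
case/andP=> /subsetP M_edges /trivIset_commonP tiM.
have same_parity (i j : C4) :
    [set i; ordS i] \in M -> [set j; ordS j] \in M -> odd i == odd j.
  move=> iM jM; apply/negPn/negP => i_j.
  have [u ui uj] : exists2 u : C4, u \in [set i; ordS i] & u \in [set j; ordS j].
    have [->|ji] := eqVneq j (ordS i).
      by exists (ordS i); rewrite !inE eqxx ?orbT.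
    exists i; rewrite !inE ?eqxx //; apply/orP; right; apply/eqP/val_inj.
    by case: i j i_j ji {iM jM} => -[|[|[|[|//]]]] ? [[|[|[|[|//]]]] ?].
  have /setP eq_ij := tiM _ _ _ iM jM ui uj.
  move: (eq_ij i) (eq_ij (ordS i)); rewrite !inE !eqxx orbT {eq_ij}.
  by case: i j i_j {iM jM ui uj} => -[|[|[|[|//]]]] ? [[|[|[|[|//]]]] ?].
have [b all_b] : exists b, forall i : C4, [set i; ordS i] \in M -> odd i == b.
  have [j jM | M0] := pickP (fun i : C4 => [set i; ordS i] \in M).
    by exists (odd j) => i iM; apply: same_parity.
  by exists true => i; rewrite M0.
exists (C4_parallel_edges b); first exact: C4_parallel_edges_perfect.
apply/subsetP=> s sM; have [i def_s] := edge_set_C4P (M_edges _ sM).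
by rewrite def_s in sM *; apply: imset_f; rewrite inE all_b.
Qed.

(** Opposite vertices have two common neighbors, which cannot both be deleted. *)
Lemma C4_two_connected : two_connected C4.
Proof.
split=> [|X X_lt2 x y]; first by rewrite card_ord.
rewrite !inE => xX yX.
set e := (X in connect X).
have eP u v : u \notin X -> v \notin X -> edge u v -> connect e u v.
  by move=> uX vX uv; apply: connect1; rewrite /e /= !inE uX vX.
have [<- | [xy | [z [z' [zz' [xz zy] [xz' z'y]]]]]] :
    x = y \/ edge x y \/
    exists z z' : C4, [/\ z != z', edge x z /\ edge z y & edge x z' /\ edge z' y].
- have [-> | x_y] := eqVneq x y; first by left.
  have [xy | nxy] := boolP (edge x y); first by right; left.
  right; right; exists (ordS x), (ordS y).
  by case: x y x_y nxy {xX yX} => -[|[|[|[|//]]]] ? [[|[|[|[|//]]]] ?].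
- exact: connect0.
- exact: eP.
have [zX | zX] := boolP (z \in X); last first.
  by apply: connect_trans (eP _ _ xX zX xz) (eP _ _ zX yX zy).
have z'X : z' \notin X.
  apply: contraL X_lt2 => z'X; rewrite -leqNgt.
  have: [set z; z'] \subset X by rewrite subUset !sub1set zX.
  by move/subset_leq_card; rewrite cards2 zz'.
by apply: connect_trans (eP _ _ xX z'X xz') (eP _ _ z'X yX z'y).
Qed.

Lemma C4_brace : brace C4.
Proof.
split; first exact: C4_two_connected.
  exists [set i : C4 | odd i] => i j; rewrite !inE.
  by case: i j => -[|[|[|[|//]]]] ? [[|[|[|[|//]]]] ?].
by move=> M /C4_matching_extends.
Qed.

Lemma C4_even_cycle_size (c : seq C4) : even_cycle c -> size c = 4.
Proof.
case/andP=> /and3P[c_gt2 _ /card_uniqP uc] even_c.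
have := max_card (mem c); rewrite uc card_ord.
by case: (size c) c_gt2 even_c => [|[|[|[|[|?]]]]].
Qed.

(** An even cycle of C4 is spanning, so the empty matching is perfect on its
    complement. *)
Lemma C4_cycle_conformal : cycle_conformal C4.
Proof.
split=> [|c cyc_c]; first by exists (C4_parallel_edges true); apply: C4_parallel_edges_perfect.
have c_all : [set x in c] = [set: C4].
  apply/eqP; rewrite eqEcard subsetT cardsT card_ord cardsE.
  by case/andP: (cyc_c) => /and3P[_ _ /card_uniqP ->] _; rewrite C4_even_cycle_size.
exists set0; rewrite c_all setCT; apply/andP; split; last first.
  by apply/eqP; apply: big_set0.
apply/andP; split; first exact: sub0set.
by apply/trivIset_commonP=> s t u; rewrite inE.
Qed.

(** Orienting each edge towards its larger end reverses only the edge joining 0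
    and 3, so a traversal has one or three forward edges. *)
Lemma C4_pfaffian : pfaffian C4.
Proof.
split; first exact: C4_cycle_conformal.1.
exists [rel i j : C4 | edge i j && (i < j)].
  split=> [x y /andP[] // | x y].
  by case: x y => -[|[|[|[|//]]]] ? [[|[|[|[|//]]]] ?].
move=> c cyc_c _; have := C4_even_cycle_size cyc_c.
case: c cyc_c => [|i [|j [|k [|l [|//]]]]] // + _ => /andP[/and3P[_]].
case: i => -[|[|[|[|//]]]] ?; case: j => -[|[|[|[|//]]]] ? //;
case: k => -[|[|[|[|//]]]] ? //; by case: l => -[|[|[|[|//]]]] ?.
Qed.

(** * The characterization *)

Theorem theorem1p2 :
  [/\ brace C4, pfaffian C4 & cycle_conformal C4] /\
  (forall G : sgraph,
     brace G -> pfaffian G -> cycle_conformal G -> isomorphic G C4).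
Proof.
split; first by split; [exact: C4_brace|exact: C4_pfaffian|exact: C4_cycle_conformal].
move=> G G_brace [_ [o o_orient o_odd]] [_ G_conf].
have [deg3 | /forallPn[v /forallPn[a /forallPn[b /existsPn Nv_ab]]]] :=
  boolP [forall v : G, forall a, forall b, exists c,
           [&& edge v c, c != a & c != b]].
  case: (@not_all_cycles_odd G o) => //.
  - by case: G_brace => -[G_gt2 _] _ _; apply: leq_trans G_gt2.
  - move=> v a b; have /existsP[c /and3P[]] := forallP (forallP (forallP deg3 v) a) b.
    by exists c.
  move=> c cyc_c; have even_c : even_cycle c.
    by apply: bipartite_cycle_even cyc_c; case: G_brace.
  by have [] := o_odd c even_c (G_conf c even_c).
apply: (@brace_degree2_C4 G v a b) => // c vc.
by have := Nv_ab c; rewrite vc /= negb_and !negbK => /orP[] /eqP; [left|right].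
Qed.
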